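(* Let $X$ be an (infinite) topological space. Then $|X|\le nh(X)^{c(X)\chi(X)}$.
   Context: A non-empty subset $A$ of a topological space $X$ is called finitely non-Hausdorff if for every non-empty finite subset $F\subseteq A$ and every family $\{U_x:x\in F\}$ where each $U_x$ is an open neighborhood of $x$, we have $\bigcap_{x\in F}U_x\neq\emptyset$. The non-Hausdorff number is $nh(X):=1+\sup\{|A|: A\subseteq X \text{ is finitely non-Hausdorff}\}$. The cellularity is $c(X):=\sup\{|\mathcal U|:\mathcal U$ a family of pairwise disjoint non-empty open subsets of $X\}+\omega$, and $\chi(X)=\sup_{x\in X}\chi(x,X)$ is the character, where $\chi(x,X)$ is the minimal cardinality of a local base at $x$. Throughout the paper, ''space'' means infinite topological space; exponentiation is cardinal exponentiation. *)

(* Defs.v *)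
(* X is a topologicalType. Cardinal inequalities are
   expressed by injections into witness types. *)
From mathcomp Require Import all_boot.
From mathcomp Require Import boolp classical_sets cardinality topology.
Set Implicit Arguments. Unset Strict Implicit. Unset Printing Implicit Defensive.
Local Open Scope classical_set_scope.

Definition fin_nonHausdorff (X : topologicalType) (A : set X) : Prop :=
  A !=set0 /\
  forall (F : set X) (U : X -> set X),
    finite_set F -> F !=set0 -> F `<=` A ->
    (forall x, F x -> open (U x) /\ U x x) ->
    (\bigcap_(x in F) U x) !=set0.

(* nh(X) <= |K|  :  1 + sup{|A| : A fin. non-Hausdorff} <= |K|,
   i.e. for every such A, |A| + 1 <= |K| (an injection of A plus a fresh point). *)
Definition nh_le (X : topologicalType) (K : Type) : Prop :=
  forall A : set X, fin_nonHausdorff A ->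
    exists (f : X -> K) (k0 : K),
      (forall a b, A a -> A b -> f a = f b -> a = b) /\
      (forall a, A a -> f a <> k0).

Definition cellular_family (X : topologicalType) (U : set (set X)) : Prop :=
  (forall V, U V -> open V /\ V !=set0) /\
  (forall V W, U V -> U W -> V <> W -> V `&` W = set0).

Definition c_le (X : topologicalType) (L : Type) : Prop :=
  (exists g : nat -> L, injective g) /\
  forall U : set (set X), cellular_family U ->
    exists f : set X -> L, forall V W, U V -> U W -> f V = f W -> V = W.

Definition local_base (X : topologicalType) (x : X) (B : set (set X)) : Prop :=
  (forall V, B V -> open V /\ V x) /\
  (forall N, nbhs x N -> exists2 V, B V & V `<=` N).

Definition chi_le (X : topologicalType) (M : Type) : Prop :=
  forall x : X, exists B : set (set X), local_base x B /\
    exists f : set X -> M, forall V W, B V -> B W -> f V = f W -> V = W.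

(* Main.v *)
Require Import Defs.
From mathcomp Require Import all_boot.
From mathcomp Require Import boolp classical_sets cardinality topology.
From mathcomp Require Import functions wochoice.
Local Open Scope classical_set_scope.
Set Implicit Arguments. Unset Strict Implicit. Unset Printing Implicit Defensive.

(* Write kappa = c(X) chi(X). Every point runs down a tree with branching codes
   in K^kappa: at a node, the set S of points with the same past is split by a
   maximal finitely non-Hausdorff H `<=` S. A point of H stops there and is
   labelled by its index in H, i.e. an element of K; by maximality, any other
   point x has a basic neighbourhood, with some index m, disjoint from a finite
   intersection O of basic neighbourhoods of points of H, and is labelled by m
   and a code of O. If x is still running at a later node, then so are the
   points y of the set H' chosen there, which share the past of x, so their m-th
   neighbourhoods miss O. Shrinking the open set O' chosen at that node by the
   m-th neighbourhood of such a y keeps it non-empty, as H' is finitely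
   non-Hausdorff, and makes it disjoint from O if both nodes use the index m.
   So x passes at most c(X) nodes with each m, hence at most kappa nodes in
   all, and its labels determine it. *)

(** * Comparability of sets and squares of infinite types *)

(** Zorn's lemma gives a maximal graph of a partial injection from [A] to [B]; if it missed a point
    on each side, that pair could be added. *)
Lemma set_inj_total (T : Type) (A B : set T) :
  (exists2 j : T -> T, set_fun A B j & set_inj A j) \/
  (exists2 j : T -> T, set_fun B A j & set_inj B j).
Proof.
pose P (G : set (T * T)) :=
  [/\ forall p, G p -> A p.1 /\ B p.2,
      forall p q, G p -> G q -> p.1 = q.1 -> p = q &
      forall p q, G p -> G q -> p.2 = q.2 -> p = q].
have [|G [[GAB Gfun Ginj] Gmax]] := @Zorn_bigcup _ P.
  move=> F FP Ftot; have common p q : (\bigcup_(X in F) X) p ->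
      (\bigcup_(X in F) X) q -> exists X, [/\ P X, X p & X q].
    move=> [X FX Xp] [Y FY Yq]; have [XY|YX] := Ftot _ _ FX FY.
      by exists Y; split; [exact: FP|exact: XY|].
    by exists X; split; [exact: FP| |exact: YX].
  split=> [p pF|p q pF qF|p q pF qF].
  - by have [X [[XAB _ _] Xp _]] := common _ _ pF pF; exact: XAB.
  - by have [X [[_ Xfun _] Xp Xq]] := common _ _ pF qF; exact: Xfun.
  - by have [X [[_ _ Xinj] Xp Xq]] := common _ _ pF qF; exact: Xinj.
have [Adom|/existsNP[a /not_implyP[Aa aG]]] :=
    pselect (forall a, A a -> exists b, G (a, b)).
  left; have /choice[j jG] : forall a, exists b, A a -> G (a, b).
    by move=> a; have [/Adom[b]|nA] := pselect (A a); [exists b|exists a].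
  exists j => [a /jG/GAB[]//|a b /set_mem Aa /set_mem Ab jab].
  by have [] := Ginj _ _ (jG _ Aa) (jG _ Ab) jab.
have [Bdom|/existsNP[b /not_implyP[Bb bG]]] :=
    pselect (forall b, B b -> exists a, G (a, b)).
  right; have /choice[j jG] : forall y, exists x, B y -> G (x, y).
    by move=> y; have [/Bdom[x]|nB] := pselect (B y); [exists x|exists y].
  exists j => [y /jG/GAB[]//|y z /set_mem By /set_mem Bz jyz].
  by have [] := Gfun _ _ (jG _ By) (jG _ Bz) jyz.
exfalso; apply: (Gmax (G `|` [set (a, b)])).
  split; first by move=> p; left.
  by move=> sub; apply: aG; exists b; apply: sub; right.
split=> [p [/GAB//|-> //]|p q|p q].
  move=> [Gp|->] [Gq|->] //= pq; first exact: Gfun.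
    by case: aG; exists p.2; rewrite -pq -surjective_pairing.
  by case: aG; exists q.2; rewrite pq -surjective_pairing.
move=> [Gp|->] [Gq|->] //= pq; first exact: Ginj.
  by case: bG; exists p.1; rewrite -pq -surjective_pairing.
by case: bG; exists q.1; rewrite pq -surjective_pairing.
Qed.

Definition pairing (T : Type) (A : set T) (f : T -> T -> T) :=
  (forall x y, A x -> A y -> A (f x y)) /\
  (forall x y x' y', A x -> A y -> A x' -> A y' ->
     f x y = f x' y' -> x = x' /\ y = y').

(** Points of [A] are tagged by [a], the others by [b], and the pairing keeps the tags apart. *)
Lemma pairing_extend (T : Type) (A B : set T) (f : T -> T -> T) (j : T -> T)
    (a b : T) :
  pairing A f -> A a -> A b -> a <> b ->
  set_fun (B `\` A) A j -> set_inj (B `\` A) j ->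
  exists2 phi, (forall x, B x -> A (phi x)) &
    (forall x y, B x -> B y -> phi x = phi y -> x = y).
Proof.
move=> [fA fI] Aa Ab ab jA jI.
exists (fun x => if `[< A x >] then f a x else f b (j x)) => [x Bx|x y Bx By].
  by case: asboolP => Ax; apply: fA => //; apply: jA.
case: asboolP => Ax; case: asboolP => Ay.
- by move/fI => [].
- by move/fI => [] //; apply: jA.
- by move/fI => [] //; [apply: jA|move=> /esym].
- move=> /fI[] // => [||_ /jI]; [exact: jA|exact: jA|].
  by apply; exact: mem_set.
Qed.


(* Zorn's lemma gives a maximal [A] with an injection [A * A -> A]. If [~` A]
   contained a copy of [A], the injection could be extended to [A] and this copy;
   hence [~` A] injects into [A], and so does [T]. *)
Lemma infinite_square (T : Type) (i : nat -> T) :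
  injective i -> exists f : T * T -> T, injective f.
Proof.
move=> iI.
(* Containing [range i] provides every [A] with the two tags [i 0] and [i 1]. *)
pose S := {p : set T * (T -> T -> T) | pairing p.1 p.2 /\ range i `<=` p.1}.
pose R (s t : S) := `[< (sval s).1 `<=` (sval t).1 /\ forall x y,
  (sval s).1 x -> (sval s).1 y -> (sval s).2 x y = (sval t).2 x y >].
have [g iK] : exists g : T -> nat, cancel i g.
  have /choice[g gP] : forall x, exists n, range i x -> i n = x.
    by move=> x; have [[n _ <-]|nx] := pselect (range i x); [exists n|exists 0].
  by exists g => n; apply: iI; apply: gP; exists n.
have S0 : S.
  exists (range i, fun x y => i (choice.pickle (g x, g y))); split=> //.
  split=> [x y _ _ /=|_ _ _ _ [m _ <-] [n _ <-] [m' _ <-] [n' _ <-] /=].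
    exact: imageT.
  by rewrite !iK => /iI/(pcan_inj choice.pickleK)[-> ->].
have [||C Ctot|[[A f] /= [Af iA]] Smax] := @ZL_preorder S S0 R.
- by move=> s; apply/asboolP; split.
- move=> r s t /asboolP[rs rsE] /asboolP[st stE]; apply/asboolP.
  split=> [x /rs/st //|x y rx ry].
  by rewrite rsE ?stE//; exact: rs.
- have [[s0 Cs0]|C0] := pselect (C !=set0); last first.
    by exists S0 => s Cs; case: C0; exists s.
  pose A := \bigcup_(s in C) (sval s).1.
  have common x y : A x -> A y ->
      exists s, [/\ C s, (sval s).1 x & (sval s).1 y].
    move=> [s Cs sx] [t Ct ty].
    have [/asboolP[st _]|/asboolP[ts _]] := Ctot _ _ Cs Ct.
      by exists t; split=> //; exact: st.
    by exists s; split=> //; exact: ts.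
  have /choice[F FP] : forall p : T * T, exists z, forall s, C s ->
      (sval s).1 p.1 -> (sval s).1 p.2 -> z = (sval s).2 p.1 p.2.
    move=> [x y] /=; have [[Ax Ay]|nA] := pselect (A x /\ A y); last first.
      by exists x => s Cs sx sy; case: nA; split; exists s.
    have [s [Cs sx sy]] := common _ _ Ax Ay.
    exists ((sval s).2 x y) => t Ct tx ty.
    have [/asboolP[_ ->]|/asboolP[_ ->]] // := Ctot _ _ Cs Ct.
  pose f x y := F (x, y).
  have Af : pairing A f /\ range i `<=` A.
    split; last by move=> x ix; exists s0 => //; exact: (svalP s0).2.
    split=> [x y Ax Ay|x y x' y' Ax Ay Ax' Ay'].
      have [s [Cs sx sy]] := common _ _ Ax Ay; exists s => //.
      by rewrite /f (FP _ _ Cs)//=; apply: (svalP s).1.1.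
    have [s [Cs sx sy]] := common _ _ Ax Ay.
    have [t [Ct tx ty]] := common _ _ Ax' Ay'.
    suff [r [Cr sr tr]] : exists r, [/\ C r, (sval s).1 `<=` (sval r).1 &
                                        (sval t).1 `<=` (sval r).1].
      rewrite /f !(FP _ _ Cr) //=; try (by apply: sr); try by apply: tr.
      by apply: (svalP r).1.2; do ?[exact: sr|exact: tr].
    have [/asboolP[st _]|/asboolP[ts _]] := Ctot _ _ Cs Ct; [exists t|exists s];
      by split=> //; exact: subset_refl.
  exists (exist _ (A, f) Af) => s Cs; apply/asboolP; split=> [x sx|x y sx sy] /=.
    by exists s.
  by rewrite /f (FP _ _ Cs).
have Ai n : A (i n) by apply: (iA); exists n.
have i01 : i 0 <> i 1 by move/iI.
have [[j jA jI]|[j jA jI]] := set_inj_total A (~` A).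
  pose B := A `|` j @` A.
  have /choice[k kP] : forall x, exists a, (j @` A) x -> A a /\ j a = x.
    move=> x; have [[a Aa <-]|nA] := pselect ((j @` A) x); first by exists a.
    by exists x.
  have BA x : (B `\` A) x -> (j @` A) x by move=> [[]].
  have [x /BA/kP[]//|x y /set_mem/BA/kP[_ kx] /set_mem/BA/kP[_ ky] kxy|] :=
    @pairing_extend _ A B f k _ _ Af (Ai 0) (Ai 1) i01.
    by rewrite -kx kxy.
  move=> phi phiA phiI.
  (* Pairs not in [A * A] are moved into [A] by [phi], paired there, and sent by [j] outside [A],
     hence away from the values of [f]. *)
  pose h x y := if `[< A x /\ A y >] then f x y else j (f (phi x) (phi y)).
  have Bh : pairing B h /\ range i `<=` B.
    split; last by move=> x /iA; left.
    split=> [x y Bx By|x y x' y' Bx By Bx' By']; rewrite /h.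
      case: asboolP => [[Ax Ay]|_]; first by left; apply: Af.1.
      by right; apply: imageP; apply: Af.1; apply: phiA.
    have Aphi u v : B u -> B v -> A (f (phi u) (phi v)).
      by move=> Bu Bv; apply: Af.1; apply: phiA.
    case: asboolP => [[Ax Ay]|_]; case: asboolP => [[Ax' Ay']|_].
    - exact: Af.2.
    - by move=> E; case: (jA (f (phi x') (phi y'))); rewrite -?E;
         [exact: Aphi|exact: Af.1].
    - by move=> E; case: (jA (f (phi x) (phi y))); rewrite ?E;
         [exact: Aphi|exact: Af.1].
    - move/jI => /(_ (mem_set (Aphi _ _ Bx By)) (mem_set (Aphi _ _ Bx' By'))).
      by move/Af.2 => []; do ?exact: phiA; move=> /phiI-> // /phiI->.
  have /asboolP[+ _] : R (exist _ (B, h) Bh) (exist _ (A, f) (conj Af iA)).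
    apply: Smax; apply/asboolP; split=> /= [x|x y Ax Ay]; first by left.
    by rewrite /h asboolT.
  move=> /= /(_ (j (i 0))) BAj; case: (jA _ (Ai 0)); apply: BAj.
  by right; exists (i 0).
have [||phi phiA phiI] := @pairing_extend _ A setT f j _ _ Af (Ai 0) (Ai 1) i01.
- by rewrite setTD.
- by rewrite setTD.
exists (fun p => f (phi p.1) (phi p.2)) => -[x y] [x' y'] /=.
by move/Af.2 => []; do ?exact: phiA; move=> /phiI-> // /phiI->.
Qed.

(** * Arithmetic of codes in [kappa -> K] *)

Section Codable.
Variables kappa K : Type.

(** The cardinal inequality |T| <= |K|^|kappa|. *)
Definition codable (T : Type) := exists f : T -> kappa -> K, injective f.

Lemma codable_inj (T U : Type) (f : T -> U) :
  injective f -> codable U -> codable T.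
Proof. by move=> fI [g gI]; exists (g \o f); exact: inj_comp. Qed.

Variables (i : nat -> kappa) (k0 k1 : K).
Hypotheses (iI : injective i) (k01 : k0 <> k1).

(** (K^kappa)^kappa = K^(kappa * kappa), and [kappa * kappa] embeds in the infinite [kappa]. *)
Lemma codable_fun (T : Type) : codable T -> codable (kappa -> T).
Proof.
move=> [f fI]; have [sq sqI] := infinite_square iI.
have [un unK] : exists un, cancel sq un.
  have /choice[un unP] : forall a, exists p, forall q, sq q = a -> p = q.
    move=> a; have [[q <-]|na] := pselect (exists q, sq q = a).
      by exists q => r /sqI.
    by exists (a, a) => q qa; case: na; exists q.
  by exists un => q; exact: unP.
exists (fun g a => f (g (un a).1) (un a).2) => g h gh.
apply/funext => a; apply: fI; apply/funext => b.
by have := congr1 (@^~ (sq (a, b))) gh; rewrite /= unK.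
Qed.

Lemma codable_bool : codable bool.
Proof.
exists (fun b _ => if b then k1 else k0) => b c /(congr1 (@^~ (i 0))).
by case: b c => [] [] // /esym.
Qed.

Lemma codable_base : codable K.
Proof. by exists (fun k _ => k) => k l /(congr1 (@^~ (i 0))). Qed.

Lemma codable_exponent : codable kappa.
Proof.
exists (fun a b => if `[< b = a >] then k1 else k0) => a b.
move=> /(congr1 (@^~ a)); rewrite asboolT//.
by case: asboolP => // _ /esym.
Qed.

(** A pair becomes a function on [kappa] with the first code at [i 0] and the second elsewhere, in
    particular at [i 1]. *)
Lemma codable_prod (T U : Type) : codable T -> codable U -> codable (T * U).
Proof.
move=> [f fI] [g gI].
apply: (@codable_inj _ (kappa -> kappa -> K)
  (fun p a => if `[< a = i 0 >] then f p.1 else g p.2)); last first.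
  by apply: codable_fun; exists id.
move=> [x y] [x' y'] E; congr pair.
  apply: fI; have := congr1 (@^~ (i 0)) E.
  by rewrite /= asboolT.
apply: gI; have := congr1 (@^~ (i 1)) E.
by rewrite /= asboolF // => /iI.
Qed.

Lemma codable_sum (T U : Type) : codable T -> codable U -> codable (T + U).
Proof.
move=> [f fI] [g gI].
apply: (@codable_inj _ (bool * (kappa -> K)) (fun s : T + U =>
  match s with inl x => (true, f x) | inr y => (false, g y) end)); last first.
  by apply: (codable_prod codable_bool); exists id.
by move=> [x|x] [y|y] // [] => [/fI|/gI] ->.
Qed.

Lemma codable_nat : codable nat.
Proof. exact: codable_inj iI codable_exponent. Qed.

Lemma codable_seq (T : Type) : codable T -> codable (seq T).
Proof.
move=> cT; have [x0|nT] := pselect (inhabited T); last first.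
  apply: (@codable_inj _ nat size _ codable_nat).
  by move=> [|x ?] [|y ?] //; case: nT.
case: x0 => x0.
have [un unK] : exists un, cancel i un.
  have /choice[un unP] : forall a, exists m, forall n, i n = a -> m = n.
    move=> a; have [[n <-]|na] := pselect (exists n, i n = a).
      by exists n => m /iI.
    by exists 0 => n ia; case: na; exists n.
  by exists un => n; exact: unP.
(* The size is recorded because padding with [x0] hides where the sequence ends. *)
apply: (@codable_inj _ (nat * (kappa -> T))
  (fun s => (size s, fun a => nth x0 s (un a)))); last first.
  exact: codable_prod codable_nat (codable_fun cT).
move=> s t [sz E]; apply: (eq_from_nth (x0 := x0)) => // n _.
by have := congr1 (@^~ (i n)) E; rewrite /= unK.
Qed.

End Codable.

(** * Cantor's diagonal argument and strict well-orders *)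

Lemma no_inj_powerset (T : Type) (e : (T -> bool) -> T) : ~ injective e.
Proof.
move=> eI; pose D t := `[< exists2 f, e f = t & f t = false >].
have [De|/asboolPn nD] := boolP (D (e D)).
  by have /asboolP[f /eI->] := De; rewrite De.
apply: (nD); exists D => //; exact/asboolPn.
Qed.

Lemma ex_strict_well_order (W : Type) : exists lt : W -> W -> Prop,
  [/\ well_founded lt, forall u v w, lt u v -> lt v w -> lt u w &
      forall v w, v <> w -> lt v w \/ lt w v].
Proof.
elim/Peq: W => W; have [R Rwo] := well_ordering_principle W.
have Rtot : total R.
  have Rchain : wo_chain R predT by move=> A _; exact: Rwo.
  by move=> x y; exact: (wo_chainW Rchain).
pose lt v w : Prop := ~~ R w v.
have ltwf : well_founded lt.
  move=> w; apply: contrapT => nacc.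
  have [|z [[zN zmin] _]] := Rwo [pred v | `[< ~ Acc lt v >]].
    by exists w; apply/asboolP.
  move/asboolP: zN; apply; constructor => v /negP Rzv.
  by apply: contrapT => nv; apply: Rzv; apply: zmin; apply/asboolP.
have lttot v w : v <> w -> lt v w \/ lt w v.
  move=> vw; rewrite /lt; have [Rvw|] := boolP (R v w); last by right.
  have [Rwv|] := boolP (R w v); last by left.
  case: vw; have [|z [_ zuniq]] := Rwo [pred u | (u == v) || (u == w)].
    by exists v; rewrite inE eqxx.
  have Rxx x : R x x by have := Rtot x x; rewrite orbb.
  by rewrite -(zuniq v) ?(zuniq w) //; split;
    rewrite ?inE ?eqxx ?orbT // => u; rewrite inE => /orP[]/eqP->.
(* A cycle of length two or three can be rotated to start at a smaller element. Transitivity then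
   follows from totality. *)
have acyclic : forall u v w, lt u v -> lt v w -> w = u \/ lt w u -> False.
  elim/(well_founded_ind ltwf) => u IH v w uv vw [wu|wu].
    by rewrite wu in vw; apply: (IH v vw u v) => //; left.
  by apply: (IH w wu u v) => //; right.
exists lt; split=> // u v w uv vw; apply: contrapT => nuw.
apply: (acyclic _ _ _ uv vw).
by have [->|/lttot[]//] := pselect (w = u); [left|right].
Qed.

(** * Splitting a node by a maximal finitely non-Hausdorff set *)

Section Topology.
Variables (X : topologicalType) (K L M : Type).
Variable V : X -> M -> set X.
Hypotheses (V_open : forall x m, open (V x m)) (V_mem : forall x m, V x m x).
Hypothesis V_base : forall x N, nbhs x N -> exists m, V x m `<=` N.
Hypothesis nhK : nh_le X K.

Lemma open_seq_bigcap (s : seq X) (U : X -> set X) :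
  (forall x, x \in s -> open (U x)) -> open (\bigcap_(x in [set` s]) U x).
Proof.
move=> sU; rewrite bigcap_seq big_seq.
by apply: (big_ind open) => //; [exact: openT|exact: openI].
Qed.

(* Finite subsets as sequences; unlike [fin_nonHausdorff], the empty set qualifies. *)
Definition seq_nonHausdorff (A : set X) := forall (s : seq X) (U : X -> set X),
  (forall x, x \in s -> A x /\ open (U x) /\ U x x) ->
  exists z, forall x, x \in s -> U x z.

(** Zorn's lemma applies because a finite subset of the union of a non-empty chain lies in one
    member. *)
Lemma maximal_nonHausdorff (S : set X) (p : X) : exists H : set X,
  [/\ H `<=` S, seq_nonHausdorff H &
      forall x, S x -> ~ H x -> ~ seq_nonHausdorff (x |` H)].
Proof.
have [|H [[HS Hfin] Hmax]] :=
    @Zorn_bigcup _ [set A | A `<=` S /\ seq_nonHausdorff A].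
  move=> F FP Ftot; split; first by apply: bigcup_sub => A /FP[].
  move=> s U sU.
  have [->|[A [FA sA]]] : s = [::] \/
      exists A, F A /\ forall x, x \in s -> A x.
    elim: s sU => [|a s IH] sU; [by left|right].
    have [[A FA Aa] _] := sU a (mem_head a s).
    have [x xs|->|[B [FB sB]]] := IH.
    - by apply: sU; rewrite in_cons xs orbT.
    - by exists A; split=> // x; rewrite inE => /eqP->.
    - have [AB|BA] := Ftot _ _ FA FB.
        by exists B; split=> // x; rewrite inE => /orP[/eqP->|/sB//]; exact: AB.
      by exists A; split=> // x; rewrite inE => /orP[/eqP->//|/sB]; exact: BA.
  - by exists p.
  - by apply: (FP _ FA).2 => x xs; have [_ ?] := sU _ xs; split=> //; exact: sA.
exists H; split=> // x Sx nHx nH; apply: (Hmax (x |` H)).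
  split; first exact: subsetUr.
  by move=> /(_ x) xH; apply: nHx; apply: xH; left.
by split=> // y [->|/HS].
Qed.

Lemma index_nonHausdorff (H : set X) : inhabited K -> seq_nonHausdorff H ->
  exists h : X -> K, forall x y, H x -> H y -> h x = h y -> x = y.
Proof.
move=> [k] Hfin; have [H0|nH] := pselect (H !=set0); last first.
  by exists (fun=> k) => x y Hx; case: nH; exists x.
suff /nhK[h [_ [hI _]]] : fin_nonHausdorff H by exists h.
split=> // F U /finite_seqP[s ->] _ sH sU.
have [x xs|z zs] := Hfin s U; last by exists z.
by split; [exact: sH|exact: sU].
Qed.

(** The labels at the node [S]: [inl] indexes a point of the maximal [H], and [inr (l, m)] records
    that [V x m] misses [O l]. The sets [Q] will form the cellular families. *)
Lemma separating_code (S : set X) (p : X) : inhabited K ->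
  exists (c : X -> K + seq (K * M) * M) (O : seq (K * M) -> set X),
  [/\ forall x y k, S x -> S y -> c x = inl k -> c y = inl k -> x = y,
      forall x l m z, S x -> c x = inr (l, m) -> V x m z -> ~ O l z &
      forall x l m, S x -> c x = inr (l, m) -> exists y Q,
        [/\ S y, open Q, Q !=set0, Q `<=` O l & Q `<=` V y m]].
Proof.
move=> iK; have [H [HS Hfin Hmax]] := maximal_nonHausdorff S p.
have [h hI] := index_nonHausdorff iK Hfin.
(* A code lists pairs of an index in [H] and a neighbourhood index; an index that no point of [H]
   has imposes no condition. *)
pose O : seq (K * M) -> set X :=
  foldr (fun q A => [set z | (forall y, H y -> h y = q.1 -> V y q.2 z) /\ A z]) setT.
have OE s xi z : (forall y : X, y \in s -> H y) ->
    O [seq (h y, xi y) | y <- s] z <-> forall y, y \in s -> V y (xi y) z.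
  elim: s => [|a s IH] sH //=.
  have {}IH := IH (fun y ys => sH y (mem_behead (s := a :: s) ys)).
  have Ha := sH a (mem_head a s).
  split=> [[az /IH sz] y|sz].
    by rewrite inE => /orP[/eqP->|/sz//]; exact: az.
  split=> [y Hy hya|].
    by rewrite (hI _ _ Hy Ha hya); apply: sz; exact: mem_head.
  by apply/IH => y ys; apply: sz; rewrite inE ys orbT.
have /choice[c cP] : forall x, exists u : K + seq (K * M) * M, S x ->
    match u with
    | inl k => H x /\ h x = k
    | inr (l, m) => (forall z, V x m z -> ~ O l z) /\ exists y Q,
        [/\ S y, open Q, Q !=set0, Q `<=` O l & Q `<=` V y m]
    end.
  move=> x; have [Hx|nHx] := pselect (H x); first by exists (inl (h x)).
  have [Sx|nSx] := pselect (S x); last by case: iK => k; exists (inl k).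
  have /existsNP[s /existsNP[U /not_implyP[sU nU]]] := Hmax x Sx nHx.
  have /choice[xi xiP] : forall y, exists m, y \in s -> V y m `<=` U y.
    move=> y; have [ys|_] := boolP (y \in s); last first.
      by have [m _] := V_base (@filterT _ (nbhs x) _); exists m.
    have [_ [Uo Uy]] := sU y ys.
    by have [m mU] := V_base (open_nbhs_nbhs (conj Uo Uy)); exists m.
  (* [s] lies in [H] together with [x]; dropping [x] leaves points of [H]. *)
  pose t := [seq y <- s | y != x].
  have tH y : y \in t -> H y.
    rewrite mem_filter => /andP[/eqP yx /sU[[]//]].
  have disj z : V x (xi x) z -> ~ O [seq (h y, xi y) | y <- t] z.
    move=> xz /(OE _ _ _ tH) tz; apply: nU; exists z => y ys.
    apply: (xiP y ys).
    have [->//|yx] := eqVneq y x; apply: tz.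
    by rewrite mem_filter yx.
  exists (inr ([seq (h y, xi y) | y <- t], xi x)) => _; split=> //.
  (* An empty [t] would make [O] the whole space, which [V x (xi x)] meets at [x]. *)
  case E : t => [|y0 t'].
    case: (disj x (V_mem x (xi x))); apply/OE => // y; by rewrite E.
  exists y0, (\bigcap_(y in [set` t]) (V y (xi y) `&` V y (xi x))); split.
  - by apply: HS; apply: tH; rewrite E mem_head.
  - by apply: open_seq_bigcap => y _; apply: openI.
  - have [y /tH Hy|z zt] := Hfin t (fun y => V y (xi y) `&` V y (xi x)).
      by split=> //; split=> //; exact: openI.
    by exists z.
  - by rewrite -E => z tz; apply/OE => // y /tz[].
  - by move=> z /(_ y0)[]//=; rewrite E mem_head.
exists c, O; split=> [x y k Sx Sy cx cy|x l m z Sx cx|x l m Sx cx].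
- have := cP x Sx; have := cP y Sy; rewrite cx cy => -[Hy hy] [Hx hx].
  by apply: hI => //; rewrite hx.
- by have := cP x Sx; rewrite cx => -[+ _]; apply.
- by have := cP x Sx; rewrite cx => -[].
Qed.

(** * The tree of labels and the coding of its branches *)

Hypothesis cL : c_le X L.

Lemma injection_of_base_indexing (p : X) :
  exists f : X -> L * M -> K, injective f.
Proof.
(* A singleton is finitely non-Hausdorff, so [K] receives its point and a fresh one. *)
have [k0 [k1 k01]] : exists k0 k1 : K, k0 <> k1.
  have [|h [k [_ hk]]] := nhK (A := [set p]).
    split; first by exists p.
    move=> F U _ _ Fp FU; exists p => x Fx; have [_] := FU x Fx.
    by rewrite (Fp x Fx).
  by exists (h p), k; exact: hk.
have [m0 _] := V_base (@filterT _ (nbhs p) _).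
have [[g gI] cellL] := cL.
pose i n : L * M := (g n, m0).
have iI : injective i by move=> a b [/gI].
have [c /choice[O cO]] := choice (fun S => separating_code S p (inhabits k0)).
(* By Cantor, [W] is too long for any point to run through; it embeds in the
   function space, so that stopping levels can be coded. *)
pose W := L * M -> bool.
have [lt [ltwf lttr lttot]] := ex_strict_well_order W.
(* The label at level [w] is read off at the node of all points with the same earlier labels. *)
pose step (w : W) (rec : forall v, lt v w -> X -> K + seq (K * M) * M) x :=
  c [set y | forall v (vw : lt v w), rec v vw y = rec v vw x] x.
pose P := Fix ltwf (fun=> X -> K + seq (K * M) * M) step.
pose S w x := [set y | forall v, lt v w -> P v y = P v x].
have PE w x : P w x = c (S w x) x.
  rewrite /P Fix_eq // => v r1 r2 r12.
  suff -> : r1 = r2 by [].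
  by apply: functional_extensionality_dep => u; apply/funext => vu; rewrite r12.
have SE w x y : S w x y -> S w y = S w x.
  move=> xy; apply/seteqP; split=> z zS v vw; first by rewrite zS// xy.
  by rewrite zS// xy.
have Sx w x : S w x x by [].
(* For each [m], the sets [Q v] at the levels with index [m] are disjoint, so they inject into [L];
   recording [m] as well gives [e]. *)
have sep x (I : set W) : (forall v, I v -> exists q, P v x = inr q) ->
    exists e : W -> L * M, set_inj I e.
  move=> Iinr.
  have /choice[d dP] : forall v, exists u : seq (K * M) * M * (X * set X), I v ->
      [/\ P v x = inr u.1, S v x u.2.1 &
      [/\ open u.2.2, u.2.2 !=set0, u.2.2 `<=` O (S v x) u.1.1 &
          u.2.2 `<=` V u.2.1 u.1.2]].
    move=> v; have [Iv|nI] := pselect (I v); last first.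
      by exists (([::], m0), (p, set0)).
    have [[l m] vx] := Iinr v Iv.
    have [_ _ /(_ x l m (Sx v x))] := cO (S v x).
    rewrite -PE => /(_ vx)[y [Q [? ? ? ? ?]]].
    by exists ((l, m), (y, Q)).
  pose mm v := (d v).1.2; pose Q v := (d v).2.2.
  (* The point [y] chosen at [w] has the label of [x] at [v], so [V y m] contains [Q w] and misses
     the set [O l] around [Q v]. *)
  have disj v w : I v -> I w -> lt v w -> mm v = mm w -> Q v `&` Q w = set0.
    rewrite /mm /Q => Iv Iw vw mvw; rewrite -subset0 => z [zv zw].
    have [Pv Sv [_ _ QO _]] := dP v Iv; have [Pw Sw [_ _ _ QV]] := dP w Iw.
    have Svw : S v x (d w).2.1.
      by move=> u uv; apply: Sw; exact: lttr vw.
    have [_ /(_ (d w).2.1 (d v).1.1 (d v).1.2 z Svw) + _] := cO (S v x).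
    apply; last exact: QO.
      by rewrite -(SE _ _ _ Svw) -PE Sw // Pv -surjective_pairing.
    by rewrite mvw; exact: QV.
  have /choice[f fP] : forall m, exists f : set X -> L, forall v w,
      I v -> I w -> mm v = m -> mm w = m -> f (Q v) = f (Q w) -> Q v = Q w.
    move=> m; have [|f fI] := cellL [set Q v | v in [set v | I v /\ mm v = m]].
      split=> [_ [v [Iv _] <-]|_ _ [v [Iv vm] <-] [w [Iw wm] <-] vw].
        by have [_ _ []] := dP v Iv.
      have [E|/lttot[|]] := pselect (v = w); first by rewrite E in vw.
        by move=> ?; apply: disj => //; rewrite vm.
      by move=> ?; rewrite setIC; apply: disj => //; rewrite vm.
    by exists f => v w Iv Iw vm wm; apply: fI; [exists v|exists w].
  exists (fun v => (f (mm v) (Q v), mm v)) => v w /set_mem Iv /set_mem Iw [+ mvw].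
  rewrite mvw => /(fP _ _ _ Iv Iw mvw erefl) QE.
  have [_ _ [_ [z Qz] _ _]] := dP v Iv.
  have Qwz : Q w z by rewrite -QE.
  have [//|/lttot[vw|wv]] := pselect (v = w).
    by have := disj _ _ Iv Iw vw mvw; move/seteqP => [/(_ z)] [].
  by have := disj _ _ Iw Iv wv (esym mvw); move/seteqP => [/(_ z)] [].
have stop x : exists w k, P w x = inl k /\
    forall v, lt v w -> exists q, P v x = inr q.
  have [w0 [k w0k]] : exists w k, P w x = inl k.
    apply: contrapT => nw.
    have [|e /in2TT eI] := sep x setT.
      move=> v _; case E : (P v x) => [k|q]; last by exists q.
      by case: nw; exists v, k.
    exact: no_inj_powerset eI.
  (* Descent to the first level with an [inl] label. *)
  elim/(well_founded_ind ltwf): w0 k w0k => w IH k wk.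
  have [[v [vw [l vl]]]|nv] := pselect (exists v, lt v w /\ exists k, P v x = inl k).
    exact: IH vl.
  exists w, k; split=> // v vw; case E : (P v x) => [l|q]; last by exists q.
  by case: nv; exists v; split=> //; exists l.
have /choice[w wP] := stop.
(* The enumeration of the levels below [u] depends on [u] alone, so points stopping at the same
   level have comparable codes. *)
have /choice[s sP] : forall u : W, exists s : L * M -> W,
    forall x, w x = u -> forall v, lt v u -> exists a, s a = v.
  move=> u; have [[x xu]|nu] := pselect (exists x, w x = u); last first.
    by exists (fun _ _ => true) => x xu; case: nu; exists x.
  have [k [_ /sep[e eI]]] := wP x; rewrite xu in eI.
  have /choice[s sP] : forall a, exists v, forall v', lt v' u -> e v' = a -> v = v'.
    move=> a; have [[v [vu <-]]|nv] := pselect (exists v, lt v u /\ e v = a).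
      by exists v => v' v'u /esym; apply: eI; exact/mem_set.
    by exists (fun=> true) => v' v'u ea; case: nv; exists v'.
  by exists s => _ _ v vu; exists (e v); exact: sP.
(* The code of [x] is its stopping level, its last label and its earlier labels. Equal codes lead to
   the same node, where equal [inl] labels identify the points. *)
apply: (codable_inj (f := fun x => (w x, (P (w x) x, fun a => P (s (w x) a) x)))).
  move=> x y [wxy Pxy Exy]; rewrite -wxy in Pxy Exy.
  have Sxy : S (w x) x y.
    move=> v vw; have [a <-] := sP _ x erefl v vw.
    by have := congr1 (@^~ a) Exy.
  have [k [xk _]] := wP x.
  have [+ _ _] := cO (S (w x) x).
  apply; [by []|exact: Sxy|by rewrite -PE; exact: xk|].
  by rewrite -(SE _ _ _ Sxy) -PE -Pxy.
have cK : codable (L * M) K K by exact: codable_base K i.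
have cM : codable (L * M) K M.
  apply: (@codable_inj _ _ _ (L * M) (fun m => (g 0, m))); first by move=> ? ? [].
  exact: codable_exponent _ k01.
have cCode : codable (L * M) K (K + seq (K * M) * M).
  apply: (codable_sum iI k01) => //; apply: (codable_prod iI) => //.
  apply: (codable_seq iI k01); exact: (codable_prod iI).
apply: (codable_prod iI).
  exact/(codable_fun iI)/(codable_bool i k01).
by apply: (codable_prod iI) => //; exact: (codable_fun iI).
Qed.

End Topology.

(* |X| <= nh(X)^(c(X) * chi(X)), stated for arbitrary witness types K, L, M
   with nh(X) <= |K|, c(X) <= |L|, chi(X) <= |M|:  X injects into (L * M -> K). *)
Theorem theorem3p1 (X : topologicalType) (K L M : Type) :
  infinite_set [set: X] ->
  nh_le X K -> c_le X L -> chi_le X M ->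
  exists f : X -> (L * M -> K), injective f.
Proof.
move=> Xinf nhK cL chiM; have [p _] := infinite_setN0 Xinf.
have /choice[V VP] : forall x : X, exists V : M -> set X,
    (forall m, open (V m) /\ V m x) /\
    forall N, nbhs x N -> exists m, V m `<=` N.
  move=> x; have [B [[Bo Bbase] [f fI]]] := chiM x.
  have /choice[V VP] : forall m, exists A, (open A /\ A x) /\
      forall C, B C -> f C = m -> A = C.
    move=> m; have [[C [BC <-]]|nC] := pselect (exists C, B C /\ f C = m).
      by exists C; split=> [|D BD /esym]; [exact: Bo|exact: fI].
    (* Indices naming no member of [B] receive the whole space. *)
    exists setT; split; first by split=> //; exact: openT.
    by move=> C BC fC; case: nC; exists C.
  exists V; split=> [m|N /Bbase[C BC CN]]; first exact: (VP m).1.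
  by exists (f C); rewrite ((VP (f C)).2 C BC erefl).
apply: (injection_of_base_indexing (V := V)) => //.
- by move=> x m; exact: ((VP x).1 m).1.
- by move=> x m; exact: ((VP x).1 m).2.
- by move=> x; exact: (VP x).2.
Qed.
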